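(* Let $N\ge2$, let $u^1,\dots,u^N$ be functions of $(x,j)\in\mathbb R\times\mathbb Z$, and put $\gamma^n=e^{u^n-u^{n+1}_1}$ for $1\le n\le N-1$. Let $R$ be the $N\times N$ matrix with all diagonal entries $1$, with $R_{n+1,n}=\gamma^n$ for $1\le n\le N-1$, and all other entries $0$. Let $S$ be the $N\times N$ matrix with $S_{n,n}=-u^n_x$ for $1\le n\le N$, $S_{n,n+1}=1$ for $1\le n\le N-1$, and all other entries $0$. Then the compatibility conditions for the equations $$\phi_1=R\phi,\qquad \phi_x=S\phi,\qquad \phi=(\phi^1,\dots,\phi^N)^T,$$ lead to the system $$\begin{aligned}u^1_x-u^1_{1,x}&=-e^{u^1-u^2_1},\\ u^n_x-u^n_{1,x}&=e^{u^{n-1}-u^n_1}-e^{u^n-u^{n+1}_1},\qquad 2\le n\le N-1,\\ u^N_x-u^N_{1,x}&=e^{u^{N-1}-u^N_1}.\end{aligned}$$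
   Context: For a function or vector $f=f(x,j)$ of a continuous variable $x$ and a discrete variable $j\in\mathbb Z$, write $f_k=f(x,j+k)$, $f_x=\partial_xf$, $f_{k,x}=\partial_x f(x,j+k)$. The compatibility condition of $\phi_1=R\phi$, $\phi_x=S\phi$ is $(\phi_1)_x=(\phi_x)_1$. *)

(* Defs.v *)
From mathcomp Require Import all_boot all_order all_algebra.
From mathcomp Require Import all_classical all_reals all_analysis.
Import Order.TTheory GRing.Theory Num.Theory.
Import numFieldNormedType.Exports.

Set Implicit Arguments.
Unset Strict Implicit.
Unset Printing Implicit Defensive.

Local Open Scope ring_scope.

Definition shiftj (K : realType) (V : Type) (f : K -> int -> V) : K -> int -> V :=
  fun x j => f x (j + 1).

Definition dx (K : realType) (V : normedModType K) (f : K -> int -> V) :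
    K -> int -> V :=
  fun x j => derive1 (fun y => f y j) x.

(* The compatibility condition (phi_1)_x = (phi_x)_1 of the pair phi_1 = A phi,
   phi_x = B phi, i.e. (A phi)_x = (B phi)_1 modulo the two equations.
   The equations are imposed on phi only at the point where the condition is
   evaluated, so that phi x j is arbitrary; for a phi solving both equations
   everywhere, the condition would hold automatically and say nothing about
   A and B. *)
Definition compatible (K : realType) (N : nat) (A B : K -> int -> 'M[K]_N) :
    Prop :=
  forall (phi : K -> int -> 'cV[K]_N) (x : K) (j : int),
    derivable (fun y => phi y j) x 1 ->
    shiftj phi x j = A x j *m phi x j ->
    dx phi x j = B x j *m phi x j ->
    dx (fun y k => A y k *m phi y k) x j =
    shiftj (fun y k => B y k *m phi y k) x j.

Section LaxPair.
(* u n is the function u^n, for 1 <= n <= N; the other values of u are unused. *)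
Variables (K : realType) (N : nat) (u : nat -> K -> int -> K).

Definition gamma (n : nat) : K -> int -> K :=
  fun x j => expR (u n x j - shiftj (u n.+1) x j).

(* The ordinals a, b : 'I_N count rows and columns from 0, so that the (a, b)
   entry below is the entry of row a + 1 and column b + 1. *)
Definition Rmat : K -> int -> 'M[K]_N := fun x j =>
  \matrix_(a < N, b < N)
    if a == b then 1
    else if a == b.+1 :> nat then gamma b.+1 x j
    else 0.

Definition Smat : K -> int -> 'M[K]_N := fun x j =>
  \matrix_(a < N, b < N)
    if a == b then - dx (u a.+1) x j
    else if b == a.+1 :> nat then 1
    else 0.

End LaxPair.

(* Main.v *)
(* As [phi x j] is arbitrary, compatibility amounts to the zero-curvature
   equation [R_x + R S = S_1 R].  Its entries off the diagonal are identities: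
   [(gamma^n)_x = gamma^n (u^n_x - u^(n+1)_(1,x))] accounts for the subdiagonal.
   The diagonal entries are the equations of the system. *)
Require Import Defs.
From mathcomp Require Import all_boot all_order all_algebra.
From mathcomp Require Import all_classical all_reals all_analysis.
From mathcomp Require Import ring.
Import Order.TTheory GRing.Theory Num.Theory.
Import numFieldNormedType.Exports.

Local Open Scope ring_scope.

Lemma is_derive_mulmx {K : realFieldType} {m n p : nat}
    {A : K -> 'M[K]_(m, n)} {B : K -> 'M[K]_(n, p)} {x : K} :
  derivable A x 1 -> derivable B x 1 ->
  is_derive x 1 (fun y => A y *m B y) ('D_1 A x *m B x + A x *m 'D_1 B x).
Proof.
move=> dA dB.
have dAij := (derivable_mxP A x 1).1 dA; have dBij := (derivable_mxP B x 1).1 dB.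
have dAB i j : is_derive x (1 : K) (fun y => (A y *m B y) i j)
    (\sum_k (A x i k * 'D_1 (fun y => B y k j) x
             + B x k j * 'D_1 (fun y => A y i k) x)).
  (* Written as a sum of products of scalar functions, the entry falls under the scalar sum and
     product rules. *)
  rewrite [X in is_derive _ _ X _](_ : _ =
    \sum_k ((fun y => A y i k) * (fun y => B y k j))); last first.
    by apply/funext => y; rewrite mxE fct_sumE.
  apply: is_derive_sum => k.
  by apply: is_deriveM; apply: derivableP.
have dM : derivable (fun y => A y *m B y) x 1.
  by apply/derivable_mxP => i j; exact: ex_derive.
apply: DeriveDef => //; rewrite derive_mx // !derive_mx //.
apply/matrixP => i j; rewrite !mxE derive_val -big_split /=.
by apply: eq_bigr => k _; rewrite !mxE; ring.
Qed.

Lemma eq_mulmx_cV {K : pzRingType} {m n : nat} {A B : 'M[K]_(m, n)} :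
  (forall v : 'cV_n, A *m v = B *m v) -> A = B.
Proof.
move=> AB; apply/matrixP => i j.
by have /matrixP/(_ i 0) := AB (delta_mx j 0); rewrite -!colE !mxE.
Qed.

(** By the product rule and the two equations, each side of the condition is a side of the matrix
    identity applied to [phi x j]. Recovering the identity itself requires every vector [v] to occur
    as such a value. *)
Lemma compatibleP {K : realType} {N : nat} {A B : K -> int -> 'M[K]_N} :
  (forall x j, derivable (fun y => A y j) x 1) ->
  compatible A B <->
  forall x j, 'D_1 (fun y => A y j) x + A x j *m B x j
              = B x (j + 1) *m A x j.
Proof.
move=> dA; split=> [cAB x j|zc phi x j dphi phi1 phix].
- apply: eq_mulmx_cV => v.
  (* [v] extends to a [phi] solving both equations at [(x, j)]. *)
  pose line (y : K) : 'cV[K]_N := v + (y - x) *: (B x j *m v).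
  have dline : is_derive x (1 : K) line (B x j *m v).
    have dlc i : is_derive x (1 : K) (fun y => line y i 0) ((B x j *m v) i 0).
      rewrite [X in is_derive _ _ X _](_ : _ =
        cst (v i 0) + (id - cst x) * cst ((B x j *m v) i 0)); last first.
        by apply/funext => y; rewrite /line !mxE.
      apply: is_derive_eq.
      by rewrite /= !fctE /= scaler0 !add0r subr0 /GRing.scale /= mulr1.
    have dl : derivable line x 1.
      by apply/derivable_mxP => i k; rewrite ord1; exact: ex_derive.
    apply: DeriveDef => //; rewrite derive_mx //.
    by apply/matrixP => i k; rewrite ord1 mxE derive_val.
  (* The value away from [j] matters only at [j + 1], where it makes [phi_1 = A phi] hold at [x]. *)
  pose phi y k := if k == j then line y else A x j *m v.
  have phij y : phi y j = line y by rewrite /phi eqxx.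
  have phixj : phi x j = v by rewrite phij /line subrr scale0r addr0.
  have phi1 : phi x (j + 1) = A x j *m v.
    by rewrite /phi -subr_eq0 [j + 1]addrC addrK oner_eq0.
  have ephi : (fun y => phi y j) = line by apply/funext.
  have := cAB phi x j; rewrite /shiftj /dx phixj phi1 !derive1E ephi.
  have -> : (fun y => A y j *m phi y j) = (fun y => A y j *m line y).
    by apply/funext => y; rewrite phij.
  have dl : derivable line x 1 by exact: ex_derive.
  have /= dAl := is_derive_mulmx (dA x j) dl.
  rewrite (@derive_val _ _ _ _ _ _ _ dline) => /(_ dl erefl erefl).
  rewrite (@derive_val _ _ _ _ _ _ _ dAl) (@derive_val _ _ _ _ _ _ _ dline).
  by rewrite -phij phixj mulmxDl !mulmxA.
- have /= dAphi := is_derive_mulmx (dA x j) dphi.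
  move: phi1 phix; rewrite /shiftj /dx !derive1E => -> phix.
  by rewrite (@derive_val _ _ _ _ _ _ _ dAphi) phix !mulmxA -mulmxDl zc.
Qed.

(** Picks out the subdiagonal entry in row [a] of R, which sits in column [a.-1]; the top row has
    none. *)
Lemma sum_pred_ord {V : nmodType} {N a : nat} (f : nat -> V) : (a < N)%N ->
  \sum_(k < N) (if a == k.+1 :> nat then f k else 0)
  = if (0 < a)%N then f a.-1 else 0.
Proof.
case: a => [|a] aN; first by rewrite big1.
by rewrite -big_mkcond (big_pred1 (Ordinal (ltnW aN))) // => k; rewrite eq_sym.
Qed.

(** The column counterpart: the subdiagonal entry of column [b] sits in row [b.+1], absent from the
    last column. *)
Lemma sum_succ_ord {V : nmodType} (N b : nat) (f : nat -> V) :
  \sum_(k < N) (if k == b.+1 :> nat then f k else 0)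
  = if (b.+1 < N)%N then f b.+1 else 0.
Proof.
rewrite -big_mkcond; case: ltnP => bN.
  by rewrite (big_pred1 (Ordinal bN)).
by rewrite big_pred0 // => k; rewrite ltn_eqF // (leq_trans (ltn_ord k)).
Qed.

Section ZeroCurvature.
Context {K : realType} {N : nat} {u : nat -> K -> int -> K}.
Context (hu : forall n : nat, (1 <= n <= N)%N ->
  forall (x : K) (j : int), derivable (fun y : K => u n y j) x 1).

(** Chain rule for the exponential; the bounds on [n] put both [n] and [n.+1] in the range of
    [hu]. *)
Lemma is_derive_gamma (n : nat) (x : K) (j : int) : (0 < n < N)%N ->
  is_derive x (1 : K) (fun y => gamma u n y j)
    (gamma u n x j * (dx (u n) x j - dx (shiftj (u n.+1)) x j)).
Proof.
move=> /andP[n0 nN].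
have dun : derivable (fun y => u n y j) x 1 by apply: hu; rewrite n0 ltnW.
have duSn : derivable (fun y => u n.+1 y (j + 1)) x 1 by exact: hu.
have dB := is_deriveB (derivableP dun) (derivableP duSn).
have := is_derive1_comp (is_derive_expR _) dB.
by rewrite /gamma /dx /shiftj !derive1E.
Qed.

Lemma is_derive_Rmat (x : K) (j : int) (a b : 'I_N) :
  is_derive x (1 : K) (fun y => Rmat N u y j a b)
    (if a == b.+1 :> nat
     then gamma u b.+1 x j * (dx (u b.+1) x j - dx (shiftj (u b.+2)) x j)
     else 0).
Proof.
under [X in is_derive _ _ X _]eq_fun do rewrite mxE.
have [->|ab] := eqVneq a b.
  by rewrite (ltn_eqF (ltnSn _)); exact: is_derive_cst.
have [abS|_] := eqVneq (a : nat) b.+1; last exact: is_derive_cst.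
by apply: is_derive_gamma; rewrite ltn0Sn -abS ltn_ord.
Qed.

Lemma derivable_Rmat (x : K) (j : int) : derivable (fun y => Rmat N u y j) x 1.
Proof.
by apply/derivable_mxP => a b; have ? := is_derive_Rmat x j a b; exact: ex_derive.
Qed.

(** R is the identity plus its subdiagonal, so multiplying by it on the left adds to each row a
    multiple of the row above. Indexing [f] by naturals lets [a.-1] appear without a bound proof. *)
Lemma mulRmat (x : K) (j : int) (f : nat -> nat -> K) (a b : 'I_N) :
  (Rmat N u x j *m \matrix_(a, b) f a b) a b
  = f a b + if (0 < a)%N then gamma u a x j * f a.-1 b else 0.
Proof.
transitivity (\sum_(k < N) ((if k == a :> nat then f k b else 0)
  + if a == k.+1 :> nat then gamma u k.+1 x j * f k b else 0)).
  rewrite mxE; apply: eq_bigr => k _; rewrite !mxE (eq_sym a).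
  have [->|ka] := eqVneq k a.
    by rewrite eqxx mul1r (ltn_eqF (ltnSn _)) addr0.
  move: ka; rewrite -val_eqE /= => /negbTE->; rewrite add0r.
  by case: ifP => // _; rewrite mul0r.
rewrite big_split /= (sum_pred_ord (fun k => gamma u k.+1 x j * f k b)) //.
rewrite -big_mkcond (big_pred1 a) //.
by case: (a : nat) => [|k].
Qed.

Lemma mulmxRmat (x : K) (j : int) (f : nat -> nat -> K) (a b : 'I_N) :
  (\matrix_(a, b) f a b *m Rmat N u x j) a b
  = f a b + if (b.+1 < N)%N then f a b.+1 * gamma u b.+1 x j else 0.
Proof.
transitivity (\sum_(k < N) ((if k == b :> nat then f a k else 0)
  + if k == b.+1 :> nat then f a k * gamma u b.+1 x j else 0)).
  rewrite mxE; apply: eq_bigr => k _; rewrite !mxE.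
  have [->|kb] := eqVneq k b.
    by rewrite eqxx mulr1 (ltn_eqF (ltnSn _)) addr0.
  move: kb; rewrite -val_eqE /= => /negbTE->; rewrite add0r.
  by case: ifP => // _; rewrite mulr0.
rewrite big_split /= (sum_succ_ord N b (fun k => f a k * gamma u b.+1 x j)).
by rewrite -big_mkcond (big_pred1 b).
Qed.

(** On the diagonal, the superdiagonal ones of S meet the subdiagonal of R: the entry above
    contributes $\gamma^a$ to $RS$, the one to the right $\gamma^{a+1}$ to $S_1R$. *)
Lemma zero_curvature_entry (x : K) (j : int) (a b : 'I_N) :
  ('D_1 (fun y => Rmat N u y j) x + Rmat N u x j *m Smat N u x j
   - Smat N u x (j + 1) *m Rmat N u x j) a b
  = if a == b then
      (if (0 < a)%N then gamma u a x j else 0)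
      - (if (a.+1 < N)%N then gamma u a.+1 x j else 0)
      - (dx (u a.+1) x j - dx (shiftj (u a.+1)) x j)
    else 0.
Proof.
pose s k (a b : nat) : K :=
  if a == b then - dx (u a.+1) x k else if b == a.+1 then 1 else 0.
have sE k : Smat N u x k = \matrix_(a, b) s k a b.
  by apply/matrixP => c d; rewrite !mxE.
rewrite !sE derive_mx; last exact: derivable_Rmat.
rewrite [LHS]mxE [X in _ + X]mxE [X in X + _]mxE mulRmat mulmxRmat !mxE.
have dR := is_derive_Rmat x j a b; rewrite derive_val {dR}.
rewrite -val_eqE /= /s.
(* Shift and derivative commute by conversion; [ring] needs them in the form in which they occur in
   $S_1$. *)
rewrite (_ : dx (shiftj (u b.+2)) x j = dx (u b.+2) x (j + 1)) //.
rewrite (_ : dx (shiftj (u a.+1)) x j = dx (u a.+1) x (j + 1)) //.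
case: a b => a aN [b _] /=.
have [<-|ab] := eqVneq a b.
  rewrite (ltn_eqF (ltnSn _)) eqxx add0r.
  case: a aN => [|a] aN; rewrite /= ?(ltn_eqF (ltnSn _)) ?eqxx.
    by case: ifP => _; ring.
  by case: ifP => _; ring.
have [abS|aSb] := eqVneq a b.+1.
  (* Subdiagonal: the derivative of [gamma] cancels against the two products of [gamma] with
     diagonal entries of S and $S_1$. *)
  rewrite -abS aN abS /= (ltn_eqF (leqnSn b.+1)) !eqxx.
  by ring.
(* Elsewhere both [gamma] terms multiply zero entries of S. What remains is
   [s j a b - s (j + 1) a b], which vanishes because S is constant off its diagonal. *)
rewrite /= eqSS [b == a]eq_sym (negbTE ab) mul0r.
case: a ab aSb aN => [|a] ab aSb aN /=; first by rewrite if_same; ring.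
rewrite eqSS in aSb; rewrite ?eqSS (negbTE aSb) [b == a.+1]eq_sym (negbTE ab).
by rewrite mulr0 if_same; ring.
Qed.

(** The conditionals encode $\gamma^0=\gamma^N=0$, which merges the two boundary equations with the
    interior ones. *)
Lemma zero_curvatureP (x : K) (j : int) :
  'D_1 (fun y => Rmat N u y j) x + Rmat N u x j *m Smat N u x j
    = Smat N u x (j + 1) *m Rmat N u x j <->
  forall a : nat, (a < N)%N ->
    dx (u a.+1) x j - dx (shiftj (u a.+1)) x j
    = (if (0 < a)%N then gamma u a x j else 0)
      - (if (a.+1 < N)%N then gamma u a.+1 x j else 0).
Proof.
split=> [zc a aN|ueq].
  have := zero_curvature_entry x j (Ordinal aN) (Ordinal aN).
  by rewrite zc subrr mxE eqxx /= => /eqP; rewrite eq_sym subr_eq0 => /eqP.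
apply/eqP; rewrite -subr_eq0; apply/eqP/matrixP => a b.
rewrite zero_curvature_entry mxE; case: eqP => // _.
by rewrite ueq // subrr.
Qed.

End ZeroCurvature.

Theorem lemma6 (K : realType) (N : nat) (hN : (2 <= N)%N)
    (u : nat -> K -> int -> K)
    (hu : forall n : nat, (1 <= n <= N)%N ->
       forall (x : K) (j : int), derivable (fun y : K => u n y j) x 1) :
  compatible (Rmat N u) (Smat N u) <->
  forall (x : K) (j : int),
    [/\ dx (u 1%N) x j - dx (shiftj (u 1%N)) x j
          = - expR (u 1%N x j - shiftj (u 2%N) x j),
        forall n : nat, (2 <= n <= N.-1)%N ->
          dx (u n) x j - dx (shiftj (u n)) x j
            = expR (u n.-1 x j - shiftj (u n) x j)
              - expR (u n x j - shiftj (u n.+1) x j)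
      & dx (u N) x j - dx (shiftj (u N)) x j
          = expR (u N.-1 x j - shiftj (u N) x j)].
Proof.
apply: (iff_trans (compatibleP (derivable_Rmat hu))).
case: N hN hu => [|[|M]] // _ hu.
split=> [zc x j|ueq x j].
- have /(zero_curvatureP hu) ueq := zc x j.
  split=> [|[|[|n]] // /andP[_ nM]|].
  + by rewrite ueq // sub0r.
  + have nM2 : (n.+2 < M.+2)%N by [].
    by rewrite (ueq n.+1 (ltnW nM2)) nM2.
  + by rewrite ueq // ltnn subr0.
- have [ueq1 ueqn ueqN] := ueq x j.
  apply/(zero_curvatureP hu) => -[|a] aM; first by rewrite ueq1 sub0r.
  (* Row [a.+1], counted from 0, carries the equation of $u^{a+2}$; with $N=M+2$ it is the last one
     exactly when [a = M]. *)
  have [->|aM'] := eqVneq a M; first by rewrite ueqN ltnn subr0.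
  have aM2 : (a.+2 < M.+2)%N by rewrite !ltnS ltn_neqAle aM'.
  by rewrite aM2 ueqn.
Qed.
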